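(* Let $d_{(1,1)}(m,n)$ and $d_{(2,0)}(m,n)$ be the number of cylindric partitions of $n$ into distinct parts where the largest part is $m$ with profiles $c=(1,1)$ and $c=(2,0)$, respectively. Let $$D_{(1,1)}(t,q)=\sum_{m,n\ge0} d_{(1,1)}(m,n)\,t^mq^n \quad\text{and}\quad D_{(2,0)}(t,q)=\sum_{m,n\ge0} d_{(2,0)}(m,n)\,t^mq^n$$ be the respective generating functions. Then $$D_{(1,1)}(1,q) = \frac{(-\sqrt{2};q)_\infty+(\sqrt{2};q)_\infty}{2},$$ $$D_{(2,0)}(1,q) = \frac{(-\sqrt{2};q)_\infty-(\sqrt{2};q)_\infty}{2\sqrt{2}},$$ $$D_{(1,1)}(1,q)+\sqrt{2}\,D_{(2,0)}(1,q) = (-\sqrt{2};q)_\infty.$$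
   Context: A partition is a finite (possibly empty) weakly decreasing sequence of positive integers $\lambda=(\lambda_1\ge\lambda_2\ge\cdots\ge\lambda_s)$; set $\lambda_j=0$ for $j>s$. For $c=(c_1,c_2)$ a pair of nonnegative integers, a cylindric partition with profile $c$ is a pair $\Lambda=(\lambda^{(1)},\lambda^{(2)})$ of partitions such that for all $j\ge 1$, $\lambda^{(1)}_j\ge \lambda^{(2)}_{j+c_2}$ and $\lambda^{(2)}_j\ge\lambda^{(1)}_{j+c_1}$. So for $c=(1,1)$ the conditions are $\lambda^{(1)}_j\ge\lambda^{(2)}_{j+1}$, $\lambda^{(2)}_j\ge\lambda^{(1)}_{j+1}$, and for $c=(2,0)$ they are $\lambda^{(1)}_j\ge\lambda^{(2)}_{j}$, $\lambda^{(2)}_j\ge\lambda^{(1)}_{j+2}$, for all $j\ge1$. $\Lambda$ is a cylindric partition of $n$ if the sum of all parts of $\lambda^{(1)}$ and $\lambda^{(2)}$ is $n$. Its largest part is the largest part occurring in $\lambda^{(1)}$ or $\lambda^{(2)}$ (equal to $0$ for the empty cylindric partition). It is into distinct parts if all the (positive) parts occurring in $\lambda^{(1)}$ and $\lambda^{(2)}$ together are pairwise distinct (no repetition within a row or between the two rows). The empty cylindric partition is counted, so $d_{(1,1)}(0,0)=d_{(2,0)}(0,0)=1$. Notation: $(a;q)_\infty=\prod_{i\ge0}(1-aq^i)$. Identities are between formal power series in $q$ with real coefficients. *)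

(* Defs.v *)
From HB Require Import structures.
From mathcomp Require Import all_boot all_order all_algebra finmap.
From mathcomp Require Import boolp classical_sets functions cardinality fsbigop.
From mathcomp Require Import reals.

Set Implicit Arguments.
Unset Strict Implicit.
Unset Printing Implicit Defensive.

Import Order.TTheory GRing.Theory Num.Theory.
Local Open Scope classical_set_scope.
Local Open Scope ring_scope.

Definition is_partition (s : seq nat) : bool := sorted geq s && all (ltn 0) s.

(* [part s j] is the part written lambda_{j+1}: indices are shifted by one, and
   parts past the end of the sequence are 0. *)
Definition part (s : seq nat) (j : nat) : nat := nth 0%N s j.

Definition cylindric (c : nat * nat) (L : seq nat * seq nat) : Prop :=
  [/\ is_partition L.1, is_partition L.2,
      forall j, (part L.2 (j + c.2) <= part L.1 j)%N
    & forall j, (part L.1 (j + c.1) <= part L.2 j)%N].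

Definition all_parts (L : seq nat * seq nat) : seq nat := L.1 ++ L.2.

Definition weight (L : seq nat * seq nat) : nat := (\sum_(x <- all_parts L) x)%N.

Definition largest_part (L : seq nat * seq nat) : nat :=
  (\max_(x <- all_parts L) x)%N.

Definition distinct_parts (L : seq nat * seq nat) : bool := uniq (all_parts L).

Definition cylindric_distinct (c : nat * nat) (m n : nat) :
    set (seq nat * seq nat) :=
  [set L | [/\ cylindric c L, distinct_parts L,
               largest_part L = m & weight L = n]].

(* [fset_set] is a junk value on infinite sets; see
   [finite_cylindric_distinct]. *)
Definition d (c : nat * nat) (m n : nat) : nat :=
  #|` fset_set (cylindric_distinct c m n)|.

(* A formal power series in q is its coefficient sequence [nat -> R^o]; the
   regular module [R^o] gives these functions their pointwise sum and their
   scaling by [R] (their pointwise product is never used). A formal power series in t and q is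
   [F : nat -> nat -> R] with [F m n] the coefficient of t^m q^n. *)
Definition D (R : realType) (c : nat * nat) : nat -> nat -> R :=
  fun m n => (d c m n)%:R.

(* Substitution t = 1. The sum is over the support of [F ^~ n], and is 0 by
   convention if that support is infinite; see [d_gt]. *)
Definition at_t1 (R : realType) (F : nat -> nat -> R) : nat -> R^o :=
  fun n => \sum_(m \in [set: nat]) F m n.

Definition qpoch (R : realType) (a : R) (N : nat) : {poly R} :=
  \prod_(i < N) (1 - a *: 'X^i).

(* (a; q)_oo: the coefficient of q^n is the one that all the partial products
   (a; q)_N with n < N share; see [qpoch_stable]. *)
Definition qpoch_inf (R : realType) (a : R) : nat -> R^o :=
  fun n => (qpoch a n.+1)`_n.

Lemma qpoch_stable (R : realType) (a : R) (n N : nat) :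
  (n < N)%N -> (qpoch a N)`_n = qpoch_inf a n.
Proof.
elim: N => // N IH; rewrite ltnS leq_eqVlt => /predU1P[-> //|nN].
rewrite /qpoch big_ord_recr /= mulrBr mulr1 -scalerAr coefB coefZ coefMXn nN.
by rewrite mulr0 subr0; exact: IH.
Qed.

Lemma leq_weight (L : seq nat * seq nat) (x : nat) :
  x \in all_parts L -> (x <= weight L)%N.
Proof. by move=> xL; rewrite /weight (big_rem x) //= leq_addr. Qed.

Lemma size_le_weight (c : nat * nat) (L : seq nat * seq nat) :
  cylindric c L -> (size (all_parts L) <= weight L)%N.
Proof.
case=> /andP[_ p1] /andP[_ p2] _ _.
have : all (ltn 0) (all_parts L) by rewrite all_cat p1.
rewrite /weight; elim: (all_parts L) => [|x s IH] /=; first by rewrite big_nil.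
by case/andP=> x0 /IH h; rewrite big_cons -add1n; exact: leq_add.
Qed.

Lemma finite_cylindric_distinct (c : nat * nat) (m n : nat) :
  finite_set (cylindric_distinct c m n).
Proof.
pose T := n.-bseq 'I_n.+1.
pose f (u : T * T) : seq nat * seq nat :=
  ([seq val i | i <- u.1], [seq val i | i <- u.2]).
apply: (@sub_finite_set _ _ (f @` setT)); last first.
  by apply: finite_image; exact: finite_finset.
move=> L [cL _ _ Ln].
have lift (s : seq nat) : (size s <= n)%N -> {subset s <= all_parts L} ->
    exists b : T, [seq val i | i <- b] = s.
  move=> sn sL; have sz : (size [seq inord x : 'I_n.+1 | x <- s] <= n)%N.
    by rewrite size_map.
  exists (Bseq sz); rewrite /= -map_comp -[RHS]map_id; apply/eq_in_map => x xs.
  by rewrite /= inordK // ltnS -Ln; exact/leq_weight/sL.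
have := size_le_weight cL; rewrite Ln size_cat => szL.
have [||b1 e1] := lift L.1.
- exact: leq_trans (leq_addr _ _) szL.
- by move=> x xL; rewrite mem_cat xL.
have [||b2 e2] := lift L.2.
- exact: leq_trans (leq_addl _ _) szL.
- by move=> x xL; rewrite mem_cat xL orbT.
by exists (b1, b2) => //; rewrite /f /= e1 e2; case: (L).
Qed.

Lemma d_gt (c : nat * nat) (m n : nat) : (n < m)%N -> d c m n = 0%N.
Proof.
move=> nm; rewrite /d (_ : cylindric_distinct c m n = set0).
  by rewrite fset_set0 cardfs0.
rewrite -subset0 => L [_ _ Lm Ln]; move: nm; rewrite ltnNge => /negP; apply.
rewrite -Lm; rewrite /largest_part big_seq.
by apply/bigmax_leqP_seq => x _ xL; rewrite -Ln; exact: leq_weight.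
Qed.

(* Main.v *)
Require Import Defs.
From mathcomp Require Import all_boot all_order all_algebra.
From mathcomp Require Import functions reals.
From mathcomp Require Import finmap boolp classical_sets cardinality fsbigop.
From mathcomp Require Import ring zify.
Import GRing.Theory Num.Theory.
Local Open Scope ring_scope.

(** Remove the largest part of a nonempty cylindric partition into distinct
parts with profile (a, b). It heads one of the two rows; if it heads the first
one, dropping it shifts that row by one place, so what remains satisfies the
interlacing conditions for the profile (a-1, b+1), and symmetrically
(a+1, b-1) for the second row. A row whose profile entry is 0 is dominated by
the other one and cannot carry the largest part. Conversely, any larger new
part may be put in front of a row within these limits. Hence, writing P_N(a, b)
for the weight polynomial of the cylindric partitions with distinct parts at
most N,

  P_{N+1}(a, b) = P_N(a, b) + q^{N+1} (P_N(a-1, b+1) + P_N(a+1, b-1)),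

where the terms with a negative profile entry are absent.

For a + b = 2 put A = P(1, 1) and B = P(2, 0) = P(0, 2). The recurrence reads
A' = A + 2 q^{N+1} B and B' = B + q^{N+1} A, which the two square roots r of 2
diagonalize: A' + r B' = (1 + r q^{N+1}) (A + r B). As A + r B = 1 + r at N = 0,
where only the empty partition is left, A + r B is the partial product of
(-r; q)_oo ([qpoch_cyl_poly]). Since a part of a partition of n is at most n,
P_n has the same coefficient of q^n as the full generating function
([at_t1_cyl_poly]), and the theorem follows by solving for the two series
from r = sqrt 2 and r = - sqrt 2.

To turn the recurrence into one between polynomials, [cyl_enum] lists the
cylindric partitions by following it; [cyl_enumP] and [cyl_enum_uniq] say that
the list is complete and without repetition. *)

(** * Removing the largest part *)

Definition swap_rows (L : seq nat * seq nat) : seq nat * seq nat := (L.2, L.1).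

Lemma cylindric_swap (a b : nat) (L : seq nat * seq nat) :
  cylindric (a, b) L -> cylindric (b, a) (swap_rows L).
Proof. by case. Qed.

Lemma is_partition_cons (x : nat) (l : seq nat) : (0 < x)%N ->
  all (fun y => y < x)%N l -> is_partition (x :: l) = is_partition l.
Proof.
move=> x0 lx; rewrite /is_partition /= x0 /=.
rewrite path_sortedE; last exact: rev_trans leq_trans.
suff -> : all (geq x) l by [].
by apply: sub_all lx => y /ltnW.
Qed.

Lemma part_le (x : nat) (l : seq nat) (j : nat) :
  all (fun y => y < x)%N l -> (part l j <= x)%N.
Proof.
move=> lx; rewrite /part; case: (ltnP j (size l)) => jl.
  by apply: ltnW; exact: (allP lx) (mem_nth _ jl).
by rewrite nth_default.
Qed.

(** Prepending a part moves the row one place to the right, which trades one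
unit of the profile between the entries; the only new condition, that [x]
dominates a part of the other row, holds because [x] is the largest. *)
Lemma cylindric_consl (x a b : nat) (l1 l2 : seq nat) : (0 < x)%N ->
  all (fun y => y < x)%N l1 -> all (fun y => y < x)%N l2 ->
  cylindric (a.+1, b) (x :: l1, l2) <-> cylindric (a, b.+1) (l1, l2).
Proof.
move=> x0 lx1 lx2; split=> -[/= p1 p2 h1 h2].
  rewrite is_partition_cons // in p1; split=> //= j.
    by have := h1 j.+1; rewrite addSnnS.
  by have := h2 j; rewrite addnS.
split=> //=; first by rewrite is_partition_cons.
  case=> [|j]; first exact: part_le.
  by have := h1 j; rewrite addSnnS.
by move=> j; have := h2 j; rewrite addnS.
Qed.

(** With profile entry 0 the second row dominates the first one termwise, so
its first part would be at least [x]. *)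
Lemma cylindric_consl0 (x b : nat) (l1 l2 : seq nat) : (0 < x)%N ->
  all (fun y => y < x)%N l2 -> ~ cylindric (0%N, b) (x :: l1, l2).
Proof.
move=> x0 lx2 [/= _ _ _ /(_ 0%N)]; rewrite /part /=.
by case: l2 lx2 => [|y l] /=; [lia|case/andP; lia].
Qed.

(** * Listing cylindric partitions by their largest part *)

Fixpoint cyl_enum (N : nat) (c : nat * nat) : seq (seq nat * seq nat) :=
  if N is M.+1 then
    cyl_enum M c
    ++ (if c is (a.+1, b) then
          [seq (N :: L.1, L.2) | L <- cyl_enum M (a, b.+1)] else [::])
    ++ (if c is (a, b.+1) then
          [seq (L.1, N :: L.2) | L <- cyl_enum M (a.+1, b)] else [::])
  else [:: ([::], [::])].

Definition bounded_cyl (N : nat) (c : nat * nat) (L : seq nat * seq nat) : Prop :=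
  [/\ cylindric c L, distinct_parts L & all (fun y => y <= N)%N (all_parts L)].

Lemma bounded_cyl_swap (N a b : nat) (L : seq nat * seq nat) :
  bounded_cyl N (a, b) L -> bounded_cyl N (b, a) (swap_rows L).
Proof.
case=> cL uL bL; split; first exact: cylindric_swap.
  by rewrite /distinct_parts /all_parts uniq_catC.
by move: bL; rewrite /all_parts !all_cat andbC.
Qed.

Lemma bounded_cyl_consl (N a b : nat) (l1 l2 : seq nat) :
  bounded_cyl N (a, b.+1) (l1, l2) ->
  bounded_cyl N.+1 (a.+1, b) (N.+1 :: l1, l2).
Proof.
case=> cL; rewrite /distinct_parts /all_parts /= => uL bL.
have := bL; rewrite all_cat => /andP[b1 b2].
split.
- exact/cylindric_consl.
- rewrite /distinct_parts /= uL andbT.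
  by apply/negP => /(allP bL); rewrite ltnn.
- by rewrite /= leqnn /=; apply: sub_all bL => y; apply: leqW.
Qed.

(** As the parts are distinct, [N.+1] can only be the head of its row, and
all the other parts are at most [N]. *)
Lemma bounded_cyl_headl (N : nat) (c : nat * nat) (L : seq nat * seq nat) :
  bounded_cyl N.+1 c L -> N.+1 \in L.1 ->
  exists a l, [/\ c.1 = a.+1, L.1 = N.+1 :: l
    & bounded_cyl N (a, c.2.+1) (l, L.2)].
Proof.
case: c L => a b [[//|x l1] l2] [cL uL bL] /= NL.
have xN : x = N.+1.
  apply/eqP; rewrite eqn_leq; move: (bL) => /= /andP[-> _] /=.
  move: NL; rewrite inE => /predU1P[->//|NL].
  case: cL => /andP[+ _] _ _ _; rewrite /sorted /=.
  rewrite path_sortedE; last exact: rev_trans leq_trans.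
  by case/andP => /allP/(_ _ NL).
subst x; move: uL bL; rewrite /distinct_parts /all_parts /=.
case/andP=> Nn u /andP[_ bL].
have bN : all (fun y => y <= N)%N (l1 ++ l2).
  apply/allP => y yl; have := allP bL _ yl; rewrite leq_eqVlt.
  by case/predU1P => // yN; move: Nn; rewrite -yN yl.
have := bN; rewrite all_cat => /andP[b1 b2].
case: a cL => [/cylindric_consl0|a] cL; first by case: cL.
by exists a, l1; split=> //; split=> //; exact/(cylindric_consl N.+1).
Qed.

Lemma cyl_enumP (N : nat) (c : nat * nat) (L : seq nat * seq nat) :
  L \in cyl_enum N c <-> bounded_cyl N c L.
Proof.
elim: N c L => [|N IH] c L.
  rewrite inE; split=> [/eqP->|].
    by split=> //; split=> //= j; rewrite /part !nth_nil.
  case=> [[/andP[_ p1] /andP[_ p2] _ _] _]; rewrite /all_parts all_cat.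
  case: L p1 p2 => [[|x l1] [|y l2]] //=; lia.
rewrite /= !mem_cat; split.
  case/or3P.
  - move/IH => [cL uL bL]; split=> //.
    by apply: sub_all bL => y; apply: leqW.
  - case: c => [[|a] b] //= /mapP[[l1 l2] /IH Ll ->] /=.
    exact: bounded_cyl_consl.
  - case: c => [a [|b]] //= /mapP[[l1 l2] /IH Ll ->] /=.
    have := bounded_cyl_consl _ _ _ _ _ (bounded_cyl_swap _ _ _ _ Ll).
    exact: bounded_cyl_swap.
move=> bL; case: (boolP (N.+1 \in L.1)) => [NL|N1].
  have [a [l [ca cl Ll]]] := bounded_cyl_headl N c L bL NL.
  case: c L {bL NL} ca cl Ll => [_ b] [_ l2] /= -> -> /IH Ll.
  by apply/or3P/Or32/mapP; exists (l, l2).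
case: (boolP (N.+1 \in L.2)) => [NL|N2].
  case: c L bL {N1} NL => [a b] [l1 l2] /bounded_cyl_swap bL NL.
  (* Exchange the rows, remove the head of the first one, exchange back. *)
  have [b' [l [/= -> -> Ll]]] := bounded_cyl_headl N _ _ bL NL.
  move: Ll => /bounded_cyl_swap/IH Ll.
  by apply/or3P/Or33/mapP; exists (l1, l).
apply/or3P/Or31/IH; case: bL => cL uL bL; split=> //.
apply/allP => y yL; have := allP bL _ yL; rewrite leq_eqVlt => /predU1P[yN|//].
by move: yL; rewrite yN /all_parts mem_cat (negbTE N1) (negbTE N2).
Qed.

Lemma cyl_enum_le (N : nat) (c : nat * nat) (L : seq nat * seq nat) :
  L \in cyl_enum N c -> N.+1 \notin L.1 /\ N.+1 \notin L.2.
Proof.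
move=> /cyl_enumP[_ _ /allP h]; split; apply/negP => NL;
  by have := h N.+1; rewrite mem_cat NL ?orbT ltnn => /(_ isT).
Qed.

(** The three blocks of the list are told apart by the place of [N.+1]: in
neither row, in the first one, or in the second one. *)
Lemma cyl_enum_uniq (N : nat) (c : nat * nat) : uniq (cyl_enum N c).
Proof.
elim: N c => [//|N IH] [a b]; rewrite /= !cat_uniq IH /=.
apply/and4P; split.
- apply/hasPn => L; rewrite mem_cat => /orP LL; apply/negP.
  move=> /cyl_enum_le[N1 N2]; case: LL.
    case: a => // a /mapP[L' _ eL].
    by move: N1; rewrite eL inE eqxx.
  case: b => // b /mapP[L' _ eL].
  by move: N2; rewrite eL inE eqxx.
- by case: a => // a; rewrite map_inj_uniq // => -[? ?] [? ?] [-> ->].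
- apply/hasPn => L; case: b => // b /mapP[L' /cyl_enum_le[N1 _] ->].
  apply/negP; case: a N1 => // a N1 /mapP[L'' _ [eL _]].
  by move: N1; rewrite eL inE eqxx.
- by case: b => // b; rewrite map_inj_uniq // => -[? ?] [? ?] [-> ->].
Qed.

(** The bound [N] on the parts is harmless as soon as it reaches the weight. *)
Lemma d_count (c : nat * nat) (m n N : nat) : (n <= N)%N ->
  d c m n = count (fun L => (largest_part L == m) && (weight L == n))
                  (cyl_enum N c).
Proof.
move=> nN; set p := fun L => _.
rewrite /d (_ : cylindric_distinct c m n =
  [set` [fset L in [seq L <- cyl_enum N c | p L]]%fset]%classic).
  rewrite set_fsetK card_fseq undup_id ?size_filter //.
  by rewrite filter_uniq // cyl_enum_uniq.
apply/seteqP; split=> L /=; rewrite inE /= mem_filter.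
  case=> cL uL Lm Ln; apply/andP; split; first by rewrite /p Lm Ln !eqxx.
  apply/cyl_enumP; split=> //; apply/allP => y yL.
  by apply: leq_trans nN; rewrite -Ln; exact: leq_weight.
by case/andP=> /andP[/eqP Lm /eqP Ln] /cyl_enumP[cL uL _].
Qed.

(** * Generating polynomials and their recurrence *)

Section WeightPolynomial.
Context {R : realType}.
Implicit Types (c : nat * nat) (N n : nat).

Definition cyl_poly N c : {poly R} := \sum_(L <- cyl_enum N c) 'X^(weight L).

(** Setting t = 1 forgets the largest part: each partition of [n] is counted
for exactly one value of [m], and that value is at most [n]. *)
Lemma at_t1_cyl_poly c n : at_t1 (D R c) n = (cyl_poly n c)`_n.
Proof.
have le_n L : weight L = n -> (largest_part L < n.+1)%N.
  move=> <-; rewrite ltnS /largest_part big_seq.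
  by apply/bigmax_leqP_seq => x _ xL; exact: leq_weight.
rewrite /at_t1 (fsbigE (index_iota 0 n.+1)) ?iota_uniq //; last first.
  by move=> m _; rewrite mem_index_iota /= -ltnNge => nm; rewrite /D d_gt.
rewrite /cyl_poly coef_sum.
under eq_bigl do rewrite in_setT.
rewrite /D.
under eq_bigr do rewrite (d_count _ _ _ _ (leqnn n)) -sum1_count natr_sum.
rewrite big_mkord.
under eq_bigr do rewrite big_mkcond.
rewrite exchange_big /=; apply: eq_bigr => L _; rewrite coefXn.
case: (eqVneq (weight L) n) => [Ln|nL]; last first.
  by rewrite big1 // => m _; rewrite andbF.
rewrite (bigD1 (Ordinal (le_n L Ln))) //= eqxx big1 ?addr0 // => m.
by rewrite -val_eqE eq_sym andbT /= => /negbTE->.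
Qed.

Lemma cyl_poly0 c : cyl_poly 0 c = 1.
Proof. by rewrite /cyl_poly big_seq1 /weight big_nil expr0. Qed.

Lemma cyl_polySl N a b :
  \sum_(L <- [seq (N.+1 :: L.1, L.2) | L <- cyl_enum N (a, b)]) 'X^(weight L)
   = 'X^(N.+1) * cyl_poly N (a, b).
Proof.
rewrite big_map mulr_sumr; apply: eq_bigr => L _.
by rewrite /weight /= big_cons exprD.
Qed.

Lemma cyl_polySr N a b :
  \sum_(L <- [seq (L.1, N.+1 :: L.2) | L <- cyl_enum N (a, b)]) 'X^(weight L)
   = 'X^(N.+1) * cyl_poly N (a, b).
Proof.
rewrite big_map mulr_sumr; apply: eq_bigr => L _.
by rewrite /weight /= !big_cat big_cons /= addnCA exprD.
Qed.

Lemma cyl_polyS11 N :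
  cyl_poly N.+1 (1, 1)%N = cyl_poly N (1, 1)%N
    + 'X^(N.+1) * (cyl_poly N (0, 2)%N + cyl_poly N (2, 0)%N).
Proof.
by rewrite {1}/cyl_poly /= !big_cat /= cyl_polySl cyl_polySr mulrDr.
Qed.

Lemma cyl_polyS20 N :
  cyl_poly N.+1 (2, 0)%N
    = cyl_poly N (2, 0)%N + 'X^(N.+1) * cyl_poly N (1, 1)%N.
Proof.
by rewrite {1}/cyl_poly /= cats0 big_cat /= cyl_polySl.
Qed.

Lemma cyl_polyS02 N :
  cyl_poly N.+1 (0, 2)%N
    = cyl_poly N (0, 2)%N + 'X^(N.+1) * cyl_poly N (1, 1)%N.
Proof.
by rewrite {1}/cyl_poly /= big_cat /= cyl_polySr.
Qed.

(** Combinatorially this is the exchange of the two rows; algebraically, both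
sides add [q^(N+1)] times the same polynomial at each step. *)
Lemma cyl_poly02 N : cyl_poly N (0, 2)%N = cyl_poly N (2, 0)%N.
Proof.
elim: N => [|N IH]; first by rewrite !cyl_poly0.
by rewrite cyl_polyS02 cyl_polyS20 IH.
Qed.

(** The combination A + r B reproduces itself up to a factor because r^2 = 2:
the term 2 q^(N+1) B in the recurrence of A is r q^(N+1) times r B. The initial value 1 + r is the factor of index 0 of the product, so
the parts at most [N] match the first [N.+1] factors. *)
Lemma qpoch_cyl_poly (r : R) N : r ^+ 2 = 2 ->
  qpoch (- r) N.+1 = cyl_poly N (1, 1)%N + r *: cyl_poly N (2, 0)%N.
Proof.
move=> r2; have rr : r%:P * r%:P = 2 :> {poly R}.
  by rewrite -polyCM -expr2 r2 polyC_natr.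
elim: N => [|N IH].
  by rewrite !cyl_poly0 /qpoch big_ord1 expr0 scaleNr opprK.
rewrite /qpoch big_ord_recr -/(qpoch _ _) IH cyl_polyS11 cyl_polyS20 cyl_poly02.
rewrite -!mul_polyC polyCN /=; ring: rr.
Qed.

Lemma qpoch_inf_at_t1 (r : R) n : r ^+ 2 = 2 ->
  qpoch_inf (- r) n = at_t1 (D R (1, 1)%N) n + r * at_t1 (D R (2, 0)%N) n.
Proof.
by move=> r2; rewrite !at_t1_cyl_poly /qpoch_inf qpoch_cyl_poly // coefD coefZ.
Qed.

End WeightPolynomial.

Theorem theorem10 (R : realType) :
  let s : R := Num.sqrt 2 in
  let D11 : nat -> R^o := at_t1 (D R (1%N, 1%N)) in
  let D20 : nat -> R^o := at_t1 (D R (2%N, 0%N)) in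
  [/\ D11 = 2^-1 *: (qpoch_inf (- s) + qpoch_inf s),
      D20 = (2 * s)^-1 *: (qpoch_inf (- s) - qpoch_inf s)
    & D11 + s *: D20 = qpoch_inf (- s)].
Proof.
move=> s D11 D20.
have s2 : s ^+ 2 = 2 by rewrite sqr_sqrtr ?ler0n.
have s0 : s != 0 by rewrite -sqrf_eq0 s2 pnatr_eq0.
have plus n := qpoch_inf_at_t1 s n s2.
have minus n : qpoch_inf s n = D11 n - s * D20 n.
  by rewrite -[s in LHS]opprK qpoch_inf_at_t1 ?sqrrN // mulNr.
split; apply/funext => n; rewrite !fctE plus ?minus -/(D11 n) -/(D20 n) //.
  by rewrite /GRing.scale /=; move: (D11 n) (D20 n) => x y; field.
rewrite /GRing.scale /=; move: (D11 n) (D20 n) => x y; field.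
by rewrite s0.
Qed.
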